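(* Let $R$ be a finite commutative ring with identity $1 \neq 0$. Then $P(R) \leq \frac{3}{4}$.
   Context: For a finite ring $R$, $P(R)$ denotes the probability that two elements of $R$ chosen at random (with replacement) have product zero, i.e. $P(R) = \frac{|Ann|}{|R\times R|}$, where $Ann = \{(x,y) \in R\times R : xy = 0\}$. *)

(* Defs.v *)
From mathcomp Require Import all_boot all_order all_algebra.

Set Implicit Arguments.
Unset Strict Implicit.
Unset Printing Implicit Defensive.

Import GRing.Theory Num.Theory.

Local Open Scope ring_scope.

Definition Ann (R : finPzRingType) : {set R * R} :=
  [set xy : R * R | xy.1 * xy.2 == 0].

Definition P (R : finPzRingType) : rat := #|Ann R|%:R / #|[set: R * R]|%:R.

(* Main.v *)
(* Among the four products of x, x + 1 with y, y + 1, at least one is nonzero,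
   since their alternating sum is 1. Hence the complement of Ann and its
   translates by (-1, 0), (0, -1) and (-1, -1) cover R x R, so that the complement
   of Ann contains at least a quarter of all pairs. *)
Require Import Defs.
From mathcomp Require Import all_boot all_order all_algebra.

Set Implicit Arguments.
Unset Strict Implicit.
Unset Printing Implicit Defensive.

Local Open Scope ring_scope.

Import GRing.Theory Num.Theory.

Lemma card_preim_translate (V : finZmodType) (A : {set V * V}) (v : V * V) :
  #|[set u : V * V | u + v \in A]| = #|A|.
Proof.
exact: on_card_preimset (onW_bij _ (Bijective (addrK v) (subrK v))).
Qed.

Lemma translates_cover (R : finNzRingType) (A := ~: Ann R) :
  [set: R * R] = A :|: [set u : R * R | u + (1, 0) \in A]
    :|: [set u : R * R | u + (0, 1) \in A] :|: [set u : R * R | u + (1, 1) \in A].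
Proof.
apply/setP => -[x y]; rewrite !inE /= !addr0 -!negb_and; apply/esym/negP.
case/andP => /andP[/andP[/eqP xy0 /eqP x1y0] /eqP xy10] /eqP x1y10.
(* If all four products vanish, expanding [(x + 1) * (y + 1)] leaves [x + 1 = 0] and expanding
   [x * (y + 1)] leaves [x = 0], so [1 = 0]. *)
move: x1y10; rewrite mulrDr x1y0 mulr1 add0r => x1.
by move: xy10; rewrite mulrDr xy0 mulr1 add0r => x0; move: x1;
  rewrite x0 add0r => /eqP; rewrite oner_eq0.
Qed.

Lemma card_pairs_le (R : finNzRingType) :
  (#|[set: R * R]| <= 4 * #|~: Ann R|)%N.
Proof.
rewrite {1}translates_cover !mulSn mul0n addn0 !addnA.
(* Each round splits off the last translate by the union bound and cancels its cardinality against
   one of the four summands. *)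
do 3![apply: leq_trans (leq_card_setU _ _) _; rewrite card_preim_translate leq_add2r].
exact: leqnn.
Qed.

(* finComNzRingType: finite commutative rings with identity 1 != 0 *)
Theorem corollary2p3 (R : finComNzRingType) : P R <= 3 / 4.
Proof.
have n_gt0 : (0 < #|[set: R * R]|)%N by apply/card_gt0P; exists 0; rewrite inE.
rewrite /P ler_pdivrMr ?ltr0n // mulrAC ler_pdivlMr // -!natrM ler_nat.
(* Adding four times the complement to both sides turns the left one into [4 * #|R * R|]; cancelling
   [3 * #|R * R|] leaves [card_pairs_le]. *)
rewrite -(leq_add2r (4 * #|~: Ann R|)%N) [X in (X + _ <= _)%N]mulnC -mulnDr.
by rewrite cardsC -cardsT mulSn addnC leq_add2l card_pairs_le.
Qed.
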